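(* There exist a commutative Noetherian local Artinian ring $R$ and a family $\{M_s\}_{s\geq 1}$ of reflexive $R$-modules such that, for every integer $s\ge 1$: (1) for every integer $i\ge 0$, $\operatorname{Ext}^i_R(M_s,R)=0$ if and only if $1\le i\le s-1$; (2) $\operatorname{Ext}^i_R(M_s^*,R)=0$ for all $i>0$. Moreover, (for the same ring $R$) there exists a non-reflexive $R$-module $L$ such that: (1$'$) $\operatorname{Ext}^i_R(L,R)=0$ for all $i>0$; (2$'$) $\operatorname{Ext}^i_R(L^*,R)\neq 0$ for all $i>0$.
   Context: For a commutative Noetherian ring $R$ and an $R$-module $M$, set $M^*=\operatorname{Hom}_R(M,R)$. An $R$-module $M$ is called reflexive if it is finite (i.e. finitely generated) and the canonical map $M\to M^{**}$ is bijective. *)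

(* Defs.v *)
From HB Require Import structures.
From mathcomp Require Import all_boot all_algebra.
From mathcomp Require Import boolp classical_sets functions.
From mathcomp Require Import freeg.

Set Implicit Arguments.
Unset Strict Implicit.
Unset Printing Implicit Defensive.

Import GRing.Theory.
Local Open Scope classical_set_scope.
Local Open Scope ring_scope.

Definition is_ideal (R : comNzRingType) (I : set R) : Prop :=
  [/\ I 0, forall x y, I x -> I y -> I (x + y) & forall a x, I x -> I (a * x)].

Definition noetherian_ring (R : comNzRingType) : Prop :=
  forall I : nat -> set R, (forall n, is_ideal (I n)) ->
    (forall n, I n `<=` I n.+1) ->
    exists N, forall n, (N <= n)%N -> I n = I N.

Definition artinian_ring (R : comNzRingType) : Prop :=
  forall I : nat -> set R, (forall n, is_ideal (I n)) ->
    (forall n, I n.+1 `<=` I n) ->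
    exists N, forall n, (N <= n)%N -> I n = I N.

Definition is_maximal_ideal (R : comNzRingType) (m : set R) : Prop :=
  [/\ is_ideal m, m <> setT &
      forall I : set R, is_ideal I -> m `<=` I -> I = m \/ I = setT].

Definition local_ring (R : comNzRingType) : Prop :=
  exists! m : set R, is_maximal_ideal m.

Definition finite_module (R : comNzRingType) (M : lmodType R) : Prop :=
  exists (n : nat) (g : 'I_n -> M),
    forall x, exists c : 'I_n -> R, x = \sum_(i < n) c i *: g i.

(* An alias of the library type of linear maps, so that it can carry the
   R-module structure (commutativity of R is used for the scaling). *)
Definition Hom (R : comNzRingType) (M N : lmodType R) : Type := {linear M -> N}.

Section HomModule.
Variables (R : comNzRingType) (M N : lmodType R).
Implicit Types f g h : Hom M N.

Lemma HomP f g : (f : M -> N) =1 g -> f = g.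
Proof.
case: f g => [f [[fD] [fZ]]] [g [[gD] [gZ]]] /= /funext fg.
move: gD gZ; rewrite -fg => gD gZ.
by rewrite (Prop_irrelevance fD gD) (Prop_irrelevance fZ gZ).
Qed.

HB.instance Definition _ := gen_eqMixin (Hom M N).
HB.instance Definition _ := gen_choiceMixin (Hom M N).

Definition hom_zero : Hom M N := \0 : {linear M -> N}.
Definition hom_opp f : Hom M N := \- (f : {linear M -> N}) : {linear M -> N}.
Definition hom_add f g : Hom M N :=
  (f : {linear M -> N}) \+ (g : {linear M -> N}) : {linear M -> N}.
Definition hom_scale (a : R) f : Hom M N :=
  a \*: (f : {linear M -> N}) : {linear M -> N}.

Lemma hom_addA : associative hom_add.
Proof. by move=> f g h; apply: HomP => x /=; rewrite addrA. Qed.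
Lemma hom_addC : commutative hom_add.
Proof. by move=> f g; apply: HomP => x /=; rewrite addrC. Qed.
Lemma hom_add0 : left_id hom_zero hom_add.
Proof. by move=> f; apply: HomP => x /=; rewrite add0r. Qed.
Lemma hom_addN : left_inverse hom_zero hom_opp hom_add.
Proof. by move=> f; apply: HomP => x /=; rewrite addNr. Qed.
HB.instance Definition _ :=
  GRing.isZmodule.Build (Hom M N) hom_addA hom_addC hom_add0 hom_addN.

Lemma hom_scaleA a b f : hom_scale a (hom_scale b f) = hom_scale (a * b) f.
Proof. by apply: HomP => x /=; rewrite scalerA. Qed.
Lemma hom_scale1 : left_id 1 hom_scale.
Proof. by move=> f; apply: HomP => x /=; rewrite scale1r. Qed.
Lemma hom_scaleDr : right_distributive hom_scale +%R.
Proof. by move=> a f g; apply: HomP => x /=; rewrite scalerDr. Qed.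
Lemma hom_scaleDl f : {morph hom_scale^~ f : a b / a + b}.
Proof. by move=> a b; apply: HomP => x /=; rewrite scalerDl. Qed.
HB.instance Definition _ := GRing.Zmodule_isLmodule.Build R (Hom M N)
  hom_scaleA hom_scale1 hom_scaleDr hom_scaleDl.
End HomModule.

Section Kernel.
Variables (R : comNzRingType) (U V : lmodType R) (f : {linear U -> V}).

Definition kerp : {pred U} := fun x => f x == 0.

Fact kerp_submod_closed : submod_closed kerp.
Proof.
split=> [|a u v]; rewrite !unfold_in ?linear0 // => /eqP fu /eqP fv.
by rewrite linearP fu fv scaler0 addr0.
Qed.
HB.instance Definition _ :=
  GRing.isSubmodClosed.Build R U kerp kerp_submod_closed.

Record Ker : Type := MkKer { ker_val : U; _ : ker_val \in kerp }.
HB.instance Definition _ := [isSub for ker_val].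
HB.instance Definition _ := [Choice of Ker by <:].
HB.instance Definition _ := [SubChoice_isSubLmodule of Ker by <:].
End Kernel.

Section Cohomology.
Variables (R : comNzRingType) (A B C : lmodType R).
Variables (f : {linear A -> B}) (g : {linear B -> C}).

(* Meant for g \o f = 0; [cohomology] is then ker g / im f, as an abelian group. *)
Definition imp : {pred Ker g} := fun z => `[< exists a, \val z = f a >].

Fact imp_zmod_closed : zmod_closed imp.
Proof.
split=> [|x y]; rewrite !unfold_in; first by apply/asboolP; exists 0; rewrite linear0 raddf0.
move=> /asboolP[a xa] /asboolP[b yb]; apply/asboolP; exists (a - b).
by rewrite (linearB f) -xa -yb.
Qed.
HB.instance Definition _ := GRing.isZmodClosed.Build (Ker g) imp imp_zmod_closed.

Definition cohomology : zmodType := Quotient.quot imp.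
End Cohomology.

Section FreeResolution.
Variable R : comNzRingType.
Implicit Type M : lmodType R.

(* The free module on the underlying set of M, with basis << x >>, x : M;
   free_eval is the R-linear map sending << x >> to x. *)
Definition free_cover M : lmodType R := {freeg M / R}.

Definition free_eval M : free_cover M -> M := fglift id.

Fact free_eval_linear M : linear (@free_eval M).
Proof.
have fB : {morph @free_eval M : u v / u - v} by exact: lift_is_additive.
have f0 : free_eval 0 = 0 :> M by rewrite -(subr0 0) fB subrr.
have fD : {morph @free_eval M : u v / u + v}.
  by move=> u v; rewrite -{1}(opprK v) fB -(sub0r v) fB f0 sub0r opprK.
move=> c u v; rewrite fD; congr (_ + _).
rewrite -[in RHS](freeg_sumE u) [c *: u]/(fgscale c u) /fgscale.
rewrite !(big_morph _ fD f0) scaler_sumr; apply: eq_bigr => x _.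
by rewrite /free_eval !liftU scalerA.
Qed.
HB.instance Definition _ M := GRing.isLinear.Build R (free_cover M) M *:%R
  (@free_eval M) (@free_eval_linear M).

(* The canonical free resolution ... -> res M 1 -> res M 0 -> M -> 0, where
   res M n is the free module on the n-th syzygy. Its exactness is proved in
   free_eval_surj, res_exact0 and res_exactS. *)
Fixpoint syzygy (M : lmodType R) (n : nat) : lmodType R :=
  if n is n'.+1 then Ker (@free_eval (syzygy M n')) else M.

Definition res M n : lmodType R := free_cover (syzygy M n).

Definition res_diff M n : {linear res M n.+1 -> res M n} :=
  (\val : Ker (@free_eval (syzygy M n)) -> res M n) \o
  @free_eval (syzygy M n.+1).

Lemma free_eval_surj M (x : M) : exists y, free_eval y = x.
Proof. by exists << x >>; rewrite /free_eval liftU scale1r. Qed.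

Lemma res_exact0 M (y : res M 0) :
  free_eval y = 0 <-> exists z, y = res_diff M 0 z.
Proof.
split=> [y0|[z ->]]; last by apply/eqP; exact: (valP (free_eval z)).
have [z zy] := free_eval_surj (MkKer (introT eqP y0 : y \in kerp _)).
by exists z; rewrite /= zy.
Qed.

Lemma res_exactS M n (y : res M n.+1) :
  res_diff M n y = 0 <-> exists z, y = res_diff M n.+1 z.
Proof.
split=> [y0|[z ->]]; last first.
  have /eqP e : free_eval (\val (free_eval z)) == 0 := valP (free_eval z).
  by rewrite /= -/(free_eval _) e.
have ey0 : free_eval y = 0 by apply: val_inj; exact: y0.
have [z zy] := free_eval_surj (MkKer (introT eqP ey0 : y \in kerp _)).
by exists z; rewrite /= zy.
Qed.
End FreeResolution.

Section Ext.
Variables (R : comNzRingType) (M N : lmodType R).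

Definition cochain n : lmodType R := Hom (res M n) N.

Definition codiff_fun n (phi : cochain n) : cochain n.+1 :=
  (phi : {linear res M n -> N}) \o res_diff M n.

Fact codiff_linear n : linear (@codiff_fun n).
Proof. by move=> a f g; apply: HomP. Qed.
HB.instance Definition _ n := GRing.isLinear.Build R (cochain n) (cochain n.+1)
  *:%R (@codiff_fun n) (@codiff_linear n).

Definition codiff n : {linear cochain n -> cochain n.+1} := @codiff_fun n.

(* Ext^i_R(M, N) = H^i(Hom_R(res M, N)), with zero cochains in degree -1
   (for i = 0 the incoming map is replaced by a zero map). *)
Definition Ext (i : nat) : zmodType :=
  if i is i'.+1 then cohomology (codiff i') (codiff i'.+1)
  else cohomology (\0 : {linear cochain 0 -> cochain 0}) (codiff 0).
End Ext.

Definition is_zero (V : zmodType) : Prop := forall x : V, x = 0.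

Definition dual (R : comNzRingType) (M : lmodType R) : lmodType R := Hom M R^o.

Section Bidual.
Variables (R : comNzRingType) (M : lmodType R).

Definition bidual_eval (x : M) : dual M -> R^o := fun f => f x.

Fact bidual_eval_linear x : linear (bidual_eval x).
Proof. by []. Qed.
HB.instance Definition _ x := GRing.isLinear.Build R (dual M) R^o *:%R
  (bidual_eval x) (bidual_eval_linear x).

Definition bidual_map (x : M) : dual (dual M) :=
  bidual_eval x : {linear dual M -> R^o}.

Definition reflexive_module : Prop := finite_module M /\ bijective bidual_map.
End Bidual.

(* Main.v *)
Require Import Defs.
From HB Require Import structures.
From mathcomp Require Import all_boot all_order all_algebra.
From mathcomp Require Import boolp classical_sets.
From mathcomp Require Import freeg.
From mathcomp Require Import ring lra.

Set Implicit Arguments.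
Unset Strict Implicit.
Unset Printing Implicit Defensive.

Import Order.TTheory GRing.Theory Num.Theory.
Local Open Scope quotient_scope.
Local Open Scope ring_scope.

(** The ring is R = k[x,y,z,v]/(v^2, z^2, xy, vx + 2xz, vy + yz, vx + y^2,
    vy - x^2) over the rationals k.  It is local with maximal ideal m,
    m^3 = 0, and its graded pieces have dimensions 1, 4, 3.

    For a scalar t let d t be the endomorphism of R^2 with rows (v, tx) and
    (y, z), and dT t its transpose.  The relations give d (2t) o d t = 0 and
    dT t o dT (2t) = 0.  The pieces of R^2 have dimensions 2, 8, 6, so such a
    sequence of maps is exact wherever both neighbouring maps carry the linear
    part onto the top part, and this holds except at one value of t: t = 1/2
    for d, but t = 1 for dT.  Along t = 1, 2, 4, ... the maps d t therefore
    form exact sequences, while their transposes are exact only strictly above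
    t = 1 (d_exact, dT_exact).  This asymmetry is the source of everything.

    Let Z_j be the kernel of d (2^j).  Then Z_j is a syzygy of Z_(j+1), so
    Ext^(n+1)(Z_(j+1), R) = Ext^n(Z_j, R), and Ext^1(Z_(j+1), R) = 0 says that
    the functionals on Z_j extend to R^2.  The transposed sequence makes them
    extend exactly when j >= 3 (Zd_extendable_iff).  All Ext^n(Z_1, R) with
    n >= 1 are nonzero (Ext_Zd2): since d (1/2) is not onto in top degree, Z_0
    has the residue field k as a direct summand, so if Ext^(n+1)(Z_1, R)
    vanished, then so would Ext^n(Z_0, R), Ext^n(k, R) and, by a filtration
    with factors k, Ext^n(Z_1, R); descending to n = 1 contradicts the
    functional on Z_0 that does not extend.  Hence Ext^n(Z_(s+2), R) vanishes
    for 1 <= n <= s - 1 and for no other n (Ext_Zd), and M_s = Z_(s+2) works: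
    it is reflexive since its functionals extend, and its dual has the
    transposed maps above t = 1 as a free resolution, which stays exact after
    dualising (Ext_dual_Zd).

    The module L is the image of dT 2.  It is resolved by dT 4, dT 8, ..., so
    its Ext modules vanish, and its dual has Z_1 as first syzygy.  The bidual of
    L is the kernel of dT 1, which contains the vector (x, y) outside L.

    Ext is handled through extension of linear maps: Ext^(n+1)(M, N) = 0 says
    that the maps from the (n+1)-st syzygy to N extend to the free module
    containing it.  Independence of the chosen syzygies (Ext1_extendable,
    Ext_shift) and invariance under direct summands (Ext_retract) all come from
    the notion of stable retract, and Ext_extension replaces the long exact
    sequence. *)

(** * Exact sequences and the vanishing of Ext *)

Section Linear.
Variable R : comNzRingType.
Implicit Types U V W P M N A B C Q : lmodType R.

Lemma linear_of U V (f : U -> V) : linear f -> exists g : {linear U -> V}, g =1 f.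
Proof.
move=> lf; pose h := GRing.isLinear.Build R U V *:%R f lf.
by exists (HB.pack_for {linear U -> V} f h).
Qed.

Lemma ker_eq0 U V (f : {linear U -> V}) (x : Ker f) : f (\val x) = 0.
Proof. by apply/eqP; exact: (valP x). Qed.

Lemma ker_lift U V (f : {linear U -> V}) (x : U) :
  f x = 0 -> exists k : Ker f, \val k = x.
Proof. by move=> /eqP fx; exists (MkKer (fx : x \in kerp f)). Qed.

Lemma factor_surj U V W (f : {linear U -> V}) (g : {linear U -> W}) :
  (forall y, exists x, f x = y) -> (forall x, f x = 0 -> g x = 0) ->
  exists h : {linear V -> W}, forall x, h (f x) = g x.
Proof.
move=> /choice[s fs] fg.
have gf x x' : f x = f x' -> g x = g x'.
  by move=> e; apply/eqP; rewrite -subr_eq0 -linearB fg // linearB e subrr.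
have [|h hE] := @linear_of V W (g \o s).
  by move=> a u v /=; rewrite -linearP; apply: gf; rewrite linearP !fs.
by exists h => x; rewrite hE; apply: gf; rewrite fs.
Qed.

Lemma factor_inj U V W (i : {linear V -> W}) (g : {linear U -> W}) :
  injective i -> (forall x, exists y, i y = g x) ->
  exists h : {linear U -> V}, forall x, i (h x) = g x.
Proof.
move=> ii /choice[s is_].
have [|h hE] := @linear_of U V s.
  by move=> a u v; apply: ii; rewrite linearP !is_ linearP.
by exists h => x; rewrite hE.
Qed.

Definition projective P := forall U V (f : {linear U -> V}) (g : {linear P -> V}),
  (forall y, exists x, f x = y) ->
  exists h : {linear P -> U}, forall x, f (h x) = g x.

Lemma free_cover_lift M V (s : M -> V) :
  exists h : {linear free_cover M -> V}, forall x, h << x >> = s x.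
Proof.
pose f : free_cover M -> V := fglift s.
have fB : {morph f : u v / u - v} by exact: lift_is_additive.
have f0 : f 0 = 0 by rewrite -(subr0 0) fB subrr.
have fD : {morph f : u v / u + v}.
  by move=> u v; rewrite -{1}(opprK v) fB -(sub0r v) fB f0 sub0r opprK.
have [|h hE] := @linear_of _ _ f.
  move=> c u v; rewrite fD; congr (_ + _).
  rewrite -[in RHS](freeg_sumE u) [c *: u]/(fgscale c u) /fgscale.
  rewrite !(big_morph _ fD f0) scaler_sumr; apply: eq_bigr => x _.
  by rewrite /f !liftU scalerA.
by exists h => x; rewrite hE /f liftU scale1r.
Qed.

Lemma free_cover_ext M V (f g : {linear free_cover M -> V}) :
  (forall x, f << x >> = g << x >>) -> f =1 g.
Proof.
move=> fg u; rewrite -(freeg_sumE u) !linear_sum; apply: eq_bigr => x _.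
have -> : << (coeff x u) *g x >> = coeff x u *: (<< x >> : free_cover M).
  apply/eqP/freeg_eqP => y.
  by rewrite [_ *: _]/(fgscale _ _) coeff_fgscale !coeffU mul1r.
by rewrite !linearZ fg.
Qed.

Lemma free_cover_projective M : projective (free_cover M).
Proof.
move=> U V f g /choice[s fs].
have [h hE] := @free_cover_lift M U (fun x => s (g << x >>)).
exists h => x; have := @free_cover_ext M V (f \o h) g.
by apply=> y /=; rewrite hE fs.
Qed.

Lemma projective_prod P Q : projective P -> projective Q -> projective (P * Q)%type.
Proof.
move=> pP pQ U V f g fs.
have [|i1 i1E] := @linear_of P (P * Q)%type (fun x => (x, 0)).
  by move=> a u v; congr pair; rewrite /= scaler0 addr0.
have [|i2 i2E] := @linear_of Q (P * Q)%type (fun x => (0, x)).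
  by move=> a u v; congr pair; rewrite /= scaler0 addr0.
have [h1 h1E] := pP _ _ f (g \o i1) fs.
have [h2 h2E] := pQ _ _ f (g \o i2) fs.
have [|h hE] := @linear_of (P * Q)%type U (fun x => h1 x.1 + h2 x.2).
  by move=> a u v /=; rewrite !linearP scalerDr addrACA.
exists h => -[x y]; rewrite hE linearD h1E h2E /= i1E i2E -linearD /=.
by congr (g _); congr pair; rewrite /= ?addr0 ?add0r.
Qed.

Lemma projective_regular : projective R^o.
Proof.
move=> U V f g fs; have [u fu] := fs (g 1).
have [|h hE] := @linear_of R^o U (fun x => x *: u).
  by move=> a b c; rewrite scalerDl scalerA.
by exists h => x; rewrite hE linearZ fu -linearZ /= [_ *: _]mulr1.
Qed.

Record short_exact U V W (i : {linear U -> V}) (p : {linear V -> W}) : Prop :=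
  ShortExact {
    se_inj : injective i;
    se_surj : forall z, exists y, p y = z;
    se_comp : forall x, p (i x) = 0;
    se_exact : forall y, p y = 0 -> exists x, y = i x }.

Lemma ker_short_exact V W (p : {linear V -> W}) :
  (forall z, exists y, p y = z) ->
  short_exact (\val : {linear Ker p -> V}) p.
Proof.
move=> ps; split => //; first exact: val_inj.
  exact: ker_eq0.
by move=> y /ker_lift[x <-]; exists x.
Qed.

(** A is a direct summand of B up to projective summands: the identity of A
    agrees with a map through B modulo a map through a projective module. *)
Definition stable_retract A B := exists Q (i : {linear A -> B}) (r : {linear B -> A})
    (a : {linear A -> Q}) (b : {linear Q -> A}),
  projective Q /\ forall x, x = r (i x) + b (a x).


(** For a syzygy i : K -> P of M this is the vanishing of Ext^1(M, N). *)
Definition extendable K P N (i : {linear K -> P}) : Prop :=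
  forall f : {linear K -> N}, exists g : {linear P -> N}, forall x, g (i x) = f x.

Section Schanuel.
Variables A B KA PA KB PB : lmodType R.
Variables (iA : {linear KA -> PA}) (pA : {linear PA -> A}).
Variables (iB : {linear KB -> PB}) (pB : {linear PB -> B}).
Hypotheses (seA : short_exact iA pA) (seB : short_exact iB pB).
Hypotheses (PAp : projective PA) (PBp : projective PB).
Hypothesis AB : stable_retract A B.

(** Lift i and r to maps of the projective covers.  The endomorphism
    1 - r i - b a of A is zero, so its lift to PA lands in KA; that lift is d. *)
Lemma syzygy_retract : exists (i : {linear PA -> PB}) (r : {linear PB -> PA})
    (i' : {linear KA -> KB}) (r' : {linear KB -> KA}) (d : {linear PA -> KA}),
  [/\ forall x, i (iA x) = iB (i' x), forall x, r (iB x) = iA (r' x) &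
      forall x, x = r' (i' x) + d (iA x)].
Proof.
case: AB => Q [i0 [r0 [a [b [Qp e]]]]].
case: seA => iAi pAs iA0 iAe; case: seB => iBi pBs iB0 iBe.
have [i iE] := PAp (i0 \o pA) pBs.
have [r rE] := PBp (r0 \o pB) pAs.
have [c cE] := Qp _ _ _ b pAs.
have [|i' i'E] := @factor_inj _ _ _ iB (i \o iA) iBi.
  by move=> x /=; have [|y ->] := iBe (i (iA x)); [rewrite iE /= iA0 linear0|exists y].
have [|r' r'E] := @factor_inj _ _ _ iA (r \o iB) iAi.
  by move=> x /=; have [|y ->] := iAe (r (iB x)); [rewrite rE /= iB0 linear0|exists y].
pose h : {linear PA -> PA} := idfun \- (r \o i) \- (c \o (a \o pA)).
have [|d dE] := @factor_inj _ _ _ iA h iAi.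
  move=> x; have [|y ->] := iAe (h x); last by exists y.
  by rewrite !linearB /= rE cE /= iE /= -addrA -opprD -e subrr.
exists i, r, i', r', d; split => // x.
  by apply: iAi; rewrite linearD dE r'E /= i'E /= iA0 !linear0 addr0 addrC subrK.
Qed.

(** The error term of the lifted maps factors through PA, hence syzygies of
    stable retracts are stable retracts; for A = B this is Schanuel's lemma. *)
Lemma stable_retract_syzygy : stable_retract KA KB.
Proof.
have [i [r [i' [r' [d [_ _ e]]]]]] := syzygy_retract.
by exists PA, i', r', iA, d.
Qed.

(** Given f on KA, extend f r' to PB and pull it back along i; the error term
    f d is already defined on all of PA. *)
Lemma extendable_retract N : extendable N iB -> extendable N iA.
Proof.
have [i [r [i' [r' [d [iE rE e]]]]]] := syzygy_retract.
move=> ext f; have [g gE] := ext (f \o r').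
exists ((g \o i) \+ (f \o d) : {linear PA -> N}) => x.
by rewrite /= iE gE /= -linearD -e.
Qed.
End Schanuel.

Lemma stable_retract_of A B (i : {linear A -> B}) (r : {linear B -> A}) :
  cancel i r -> stable_retract A B.
Proof.
move=> ir; exists R^o, i, r, \0, \0; split; first exact: projective_regular.
by move=> x; rewrite /= addr0 ir.
Qed.

Lemma stable_retract_refl A : stable_retract A A.
Proof. exact: (@stable_retract_of A A idfun idfun). Qed.

Definition free_ker M : {linear Ker (@free_eval R M) -> free_cover M} := \val.

Lemma free_eval_exact M : short_exact (free_ker M) (@free_eval R M).
Proof. exact/ker_short_exact/free_eval_surj. Qed.

Lemma is_zero_cohomology U V W (f : {linear U -> V}) (g : {linear V -> W}) :
  is_zero (cohomology f g) <-> forall y, g y = 0 -> exists x, y = f x.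
Proof.
split=> [z0 y /ker_lift[z <-]|fg x].
  have /eqP : z == 0 %[mod cohomology f g] by apply/eqP; rewrite [LHS]z0 [RHS]z0.
  move/eqP; rewrite -Quotient.idealrBE subr0 unfold_in => /asboolP.
  exact.
have : repr x == 0 %[mod cohomology f g].
  by rewrite -Quotient.idealrBE unfold_in; apply/asboolP/fg; exact: ker_eq0.
by rewrite reprK => /eqP->; rewrite raddf0.
Qed.

Lemma Ext0_eq0 M N (f : {linear M -> N}) :
  is_zero (Ext M N 0) -> forall x, f x = 0.
Proof.
move=> /is_zero_cohomology H x.
have [|g gE] := H (f \o @free_eval R M : {linear _ -> _}).
  apply: HomP => y /=; have /eqP -> : free_eval (\val (free_eval y)) == 0.
    by apply/eqP; exact: (ker_eq0 (free_eval y)).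
  by rewrite linear0.
have [y <-] := free_eval_surj x.
exact: (congr1 (fun F : Defs.Hom (res M 0) N => (F : {linear _ -> _}) y) gE).
Qed.

(** Cocycles are the maps out of the resolution that factor through the next
    syzygy, and coboundaries are those whose factor extends. *)
Lemma Ext_extendable M N n :
  is_zero (Ext M N n.+1) <-> extendable N (free_ker (syzygy M n)).
Proof.
rewrite [Ext _ _ _]/= is_zero_cohomology; split=> [H f|H g g0].
  have [|h hE] := H (f \o @free_eval R (syzygy M n.+1) : {linear _ -> _}).
    apply: HomP => x /=; have /eqP -> : free_eval (\val (free_eval x)) == 0.
      by apply/eqP; exact: (ker_eq0 (free_eval x)).
    by rewrite linear0.
  exists h => x; have [y <-] := free_eval_surj x.
  have := congr1 (fun F : Defs.Hom (res M n.+1) N => (F : {linear _ -> _}) y) hE.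
  by move=> /= ->.
have [|f fE] := @factor_surj _ _ N (@free_eval R (syzygy M n.+1))
    (g : {linear _ -> _}) (@free_eval_surj _ _).
  move=> x x0; have /res_exactS[z ->] : res_diff M n x = 0 by rewrite /= x0.
  exact: (congr1 (fun F : Defs.Hom (res M n.+2) N => (F : {linear _ -> _}) z) g0).
by have [h hE] := H f; exists h; apply: HomP => x; rewrite -fE -hE.
Qed.

Lemma stable_retract_syz A B n :
  stable_retract A B -> stable_retract (syzygy A n) (syzygy B n).
Proof.
move=> AB; elim: n => //= n IH.
exact: (stable_retract_syzygy (free_eval_exact _) (free_eval_exact _)
  (@free_cover_projective _) (@free_cover_projective _) IH).
Qed.

Lemma Ext_retract A B N n : stable_retract A B ->
  is_zero (Ext B N n.+1) -> is_zero (Ext A N n.+1).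
Proof.
move=> AB; rewrite !Ext_extendable.
exact: (extendable_retract (free_eval_exact _) (free_eval_exact _)
  (@free_cover_projective _) (@free_cover_projective _) (stable_retract_syz n AB)).
Qed.

Section Shift.
Variables (K P M N : lmodType R) (i : {linear K -> P}) (p : {linear P -> M}).
Hypotheses (se : short_exact i p) (Pp : projective P).

Lemma Ext1_extendable : is_zero (Ext M N 1) <-> extendable N i.
Proof.
rewrite Ext_extendable; split; apply: extendable_retract; 
  eauto using free_eval_exact, free_cover_projective, stable_retract_refl.
Qed.

Lemma syzygySl n : syzygy M n.+1 = syzygy (Ker (@free_eval R M)) n.
Proof.
elim: n => // n IH.
exact: (congr1 (fun X : lmodType R => Ker (@free_eval R X) : lmodType R) IH).
Qed.

Lemma Ext_shift n : is_zero (Ext M N n.+2) <-> is_zero (Ext K N n.+1).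
Proof.
rewrite Ext_extendable syzygySl -Ext_extendable.
by split; apply/Ext_retract/stable_retract_syzygy;
  eauto using free_eval_exact, free_cover_projective, stable_retract_refl.
Qed.
End Shift.

Section Horseshoe.
Variables (A B C N : lmodType R) (i : {linear A -> B}) (p : {linear B -> C}).
Hypothesis se : short_exact i p.

(** A free cover of B built from free covers of A and C; its kernel is an
    extension of the syzygy of C by that of A. *)
Lemma horseshoe : exists (q : {linear (free_cover A * free_cover C)%type -> B})
    (j : {linear Ker (@free_eval R A) -> Ker q})
    (k : {linear Ker q -> Ker (@free_eval R C)}),
  [/\ forall b, exists x, q x = b, short_exact j k,
      forall a, \val (j a) = (\val a, 0) & forall x, \val (k x) = (\val x).2].
Proof.
case: se => ii ps pi0 pe.
have [s sE] := @free_cover_projective C _ _ p (@free_eval R C) ps.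
pose q : {linear (free_cover A * free_cover C)%type -> B} :=
  (i \o (@free_eval R A \o fst)) \+ (s \o snd).
have [|inl inlE] := @linear_of (free_cover A) (free_cover A * free_cover C)%type
    (fun a => (a, 0)).
  by move=> c u v; congr pair; rewrite /= scaler0 addr0.
have [|j jE] := @factor_inj _ _ _ (\val : {linear Ker q -> _})
    (inl \o free_ker A) val_inj.
  move=> a; have [|x xE] := @ker_lift _ _ q ((inl \o free_ker A) a); last by exists x.
  by rewrite /= inlE /= linear0 addr0 ker_eq0 linear0.
have [|k kE] := @factor_inj _ _ _ (free_ker C) (snd \o (\val : {linear Ker q -> _}))
    val_inj.
  move=> x; have [|y yE] := @ker_lift _ _ (@free_eval R C) (\val x).2.
    by rewrite -sE -[s _]add0r -(subrr (i (free_eval (\val x).1))) addrAC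
      -[_ + s _]/(q (\val x)) ker_eq0 sub0r linearN pi0 oppr0.
  by exists y.
exists q, j, k; split.
- move=> b; have [c cE] := free_eval_surj (p b).
  have [|a' aE] := pe (b - s c); first by rewrite linearB sE /= cE subrr.
  by have [a aE'] := free_eval_surj a'; exists (a, c); rewrite /= aE' -aE subrK.
- split.
  + move=> a a' /(congr1 \val); rewrite !jE /= !inlE => -[/val_inj].
    exact.
  + move=> y; have [|a' aE] := pe (s (\val y)); first by rewrite sE ker_eq0.
    have [a aE'] := free_eval_surj (- a').
    have [|x xE] := @ker_lift _ _ q (a, \val y).
      by rewrite /= aE' aE linearN addNr.
    by exists x; apply: val_inj; rewrite [LHS]kE /= xE.
  + by move=> a; apply: val_inj; rewrite [LHS]kE -[LHS]/((\val (j a)).2) jE /= inlE.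
  + move=> x x0; have x20 : (\val x).2 = 0 by rewrite -[LHS]kE x0.
    have [|a aE] := @ker_lift _ _ (@free_eval R A) (\val x).1.
      apply: ii; rewrite linear0; have := ker_eq0 x.
      by rewrite /= x20 linear0 addr0.
    exists a; apply: val_inj; rewrite jE /= inlE -[LHS]/(\val x).
    by rewrite [LHS]surjective_pairing x20 -aE.
- by move=> a; rewrite jE /= inlE.
- exact: kE.
Qed.
End Horseshoe.

(** The middle of the long exact sequence.  The horseshoe construction reduces
    every degree to the first.  There, given f on the syzygy of B, extend its
    restriction to the syzygy of A; the difference factors through the syzygy
    of C and extends as well. *)
Lemma Ext_extension A B C N n (i : {linear A -> B}) (p : {linear B -> C}) :
  short_exact i p -> is_zero (Ext A N n.+1) -> is_zero (Ext C N n.+1) ->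
  is_zero (Ext B N n.+1).
Proof.
elim: n A B C i p => [|n IH] A B C i p se.
  have [q [j [k [qs [ji ks kj0 ke] jE kE]]]] := horseshoe se.
  have PP := projective_prod (@free_cover_projective A) (@free_cover_projective C).
  rewrite (Ext1_extendable N (ker_short_exact qs) PP).
  rewrite !Ext_extendable => extA extC f.
  have [g gE] := extA (f \o j).
  pose g' : {linear free_cover A -> N} := g.
  have [|h0 h0E] := @factor_surj _ _ N k 
    (f \- (g' \o (fst \o (\val : {linear Ker q -> _})))) ks.
    by move=> x /ke[a ->]; rewrite -[LHS]/(f (j a) - g' (\val (j a)).1) jE [g' _]gE subrr.
  have [h hE] := extC h0.
  pose h' : {linear free_cover C -> N} := h.
  exists ((g' \o fst) \+ (h' \o snd)
    : {linear (free_cover A * free_cover C)%type -> N}) => x.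
  by rewrite /= -[_.2]kE [h' _]hE h0E /= addrC subrK.
have [q [j [k [qs jk _ _]]]] := horseshoe se.
have PP := projective_prod (@free_cover_projective A) (@free_cover_projective C).
rewrite (Ext_shift N (ker_short_exact qs) PP).
rewrite !(Ext_shift N (free_eval_exact _) (@free_cover_projective _)).
exact: IH jk.
Qed.

End Linear.

Section Image.
Variables (R : comNzRingType) (U V : lmodType R) (f : {linear U -> V}).

Definition imagep : {pred V} := fun y => `[< exists x, y = f x >].

Fact imagep_submod_closed : submod_closed imagep.
Proof.
split=> [|a u v]; rewrite !unfold_in; first by apply/asboolP; exists 0; rewrite linear0.
move=> /asboolP[x ->] /asboolP[y ->]; apply/asboolP.
by exists (a *: x + y); rewrite linearP.
Qed.
HB.instance Definition _ :=
  GRing.isSubmodClosed.Build R V imagep imagep_submod_closed.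

Record Img : Type := MkImg { img_val : V; _ : img_val \in imagep }.
HB.instance Definition _ := [isSub for img_val].
HB.instance Definition _ := [Choice of Img by <:].
HB.instance Definition _ := [SubChoice_isSubLmodule of Img by <:].

Lemma img_cover : exists b : {linear U -> Img},
  (forall y, exists x, b x = y) /\ (forall x, \val (b x) = f x).
Proof.
have [|b bE] := @factor_inj R U Img V (\val : {linear Img -> V}) f val_inj.
  move=> x; have xi : f x \in imagep by rewrite unfold_in; apply/asboolP; exists x.
  by exists (MkImg xi).
exists b; split=> // y; have := valP y; rewrite unfold_in => /asboolP[x yE].
by exists x; apply: val_inj; rewrite [LHS]bE -yE.
Qed.
End Image.


(** * Submodules of a free module of rank two and their duals *)

Section Rank2.
Variable R : comNzRingType.

Definition R2 : lmodType R := (R^o * R^o)%type.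

Definition dot (u w : R2) : R^o := u.1 * w.1 + u.2 * w.2.

Lemma dotC u w : dot u w = dot w u.
Proof. by rewrite /dot ![u.1 * _]mulrC ![u.2 * _]mulrC. Qed.

Fact dot_linear u : linear (dot u).
Proof.
case: u => u v a [x y] [x' y'].
change (u * (a * x + x') + v * (a * y + y') =
  a * (u * x + v * y) + (u * x' + v * y') :> R); ring.
Qed.
HB.instance Definition _ u :=
  GRing.isLinear.Build R R2 R^o *:%R (dot u) (dot_linear u).

Lemma functional_dot (f : {linear R2 -> R^o}) : exists u, f =1 dot u.
Proof.
exists (f (1, 0), f (0, 1)) => -[x y].
have -> : (x, y) = x *: ((1, 0) : R2) + y *: ((0, 1) : R2) :> R2.
  by congr pair; rewrite /= [_ *: 1]mulr1 [_ *: 0]mulr0 ?addr0 ?add0r.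
by rewrite linearD !linearZ dotC /dot /= [x *: 0]mulr0 [y *: 0]mulr0
  [x *: 1]mulr1 [y *: 1]mulr1 addr0 add0r.
Qed.

Lemma dot_eq0 u : (forall w, dot u w = 0) -> u = 0.
Proof.
move=> u0; have := u0 (1, 0); have := u0 (0, 1).
by rewrite /dot /= !mulr1 !mulr0 addr0 add0r => u2 u1; case: u u1 u2 u0 => a b /= -> ->.
Qed.

Lemma R2_projective : projective R2.
Proof. by apply: projective_prod; apply: projective_regular. Qed.

Definition mat (a b c d : R) (u : R2) : R2 := (a * u.1 + b * u.2, c * u.1 + d * u.2).

Fact mat_linear a b c d : linear (mat a b c d).
Proof.
move=> k [x y] [x' y']; congr pair.
  change (a * (k * x + x') + b * (k * y + y') =
    k * (a * x + b * y) + (a * x' + b * y') :> R); ring.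
change (c * (k * x + x') + d * (k * y + y') =
  k * (c * x + d * y) + (c * x' + d * y') :> R); ring.
Qed.
HB.instance Definition _ a b c d :=
  GRing.isLinear.Build R R2 R2 *:%R (mat a b c d) (@mat_linear a b c d).

Lemma dot_mat a b c d u w : dot u (mat a b c d w) = dot (mat a c b d u) w.
Proof.
case: u w => u v [x y].
change (u * (a * x + b * y) + v * (c * x + d * y) =
  (a * u + c * v) * x + (b * u + d * v) * y :> R); ring.
Qed.

Section Submodule.
Variables (S : lmodType R) (i : {linear S -> R2}) (b : {linear R2 -> S}).
Hypothesis bs : forall x, exists w, b w = x.

Variable B' : {linear R2 -> R2}.
Hypothesis BB' : forall u w, dot u (i (b w)) = dot (B' u) w.

(** With S = im B and functionals on R^2 written as vectors, a functional on S
    pulls back to a vector y killed by the transpose C' of the previous map.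
    Exactness of the transposed sequence gives y = B' y', and y' extends the
    functional. *)
Lemma functionals_extend (C C' : {linear R2 -> R2}) :
  (forall u w, dot u (C w) = dot (C' u) w) -> (forall w, b (C w) = 0) ->
  (forall y, C' y = 0 -> exists y', y = B' y') -> extendable R^o i.
Proof.
move=> CC' bC CB f; have [y yE] := functional_dot (f \o b).
have [|y' y'E] := CB y.
  by apply: dot_eq0 => w; rewrite -CC' -yE /= bC linear0.
exists (dot y') => x; have [w <-] := bs x.
by rewrite /= BB' -y'E -yE.
Qed.

(** Such a y descends to a functional on S; an extension u of it would satisfy
    B' u = y. *)
Lemma functional_not_extend y :
  (forall w, b w = 0 -> dot y w = 0) -> (forall u, B' u <> y) ->
  ~ extendable R^o i.
Proof.
move=> by0 yB ext; have [f fE] := @factor_surj _ _ _ _ b (dot y) bs by0.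
have [g gE] := ext f; have [u uE] := functional_dot g.
apply: (yB u); apply/eqP; rewrite -subr_eq0; apply/eqP/dot_eq0 => w.
by rewrite dotC linearB /= ![dot w _]dotC -BB' -uE gE fE subrr.
Qed.

Lemma finite_cover : finite_module S.
Proof.
exists 2%N, (fun k : 'I_2 => if k == 0 then b (1, 0) else b (0, 1)) => x.
have [w <-] := bs x; exists (fun k => if k == 0 then w.1 else w.2).
rewrite big_ord_recl big_ord1 /= -!linearZ -linearD; congr (b _).
by case: w => u v; congr pair; rewrite /= [_ *: 1]mulr1 [_ *: 0]mulr0 ?addr0 ?add0r.
Qed.

Hypothesis ii : injective i.
Hypothesis ext : extendable R^o i.

(** The dual of S is the quotient of R^2 by the vectors orthogonal to S. *)
Lemma dual_cover : exists th : {linear R2 -> dual S},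
  (forall f, exists v, th v = f) /\
  (forall v (x : S), (th v : {linear S -> R^o}) x = dot v (i x)).
Proof.
have [|th thE] := @linear_of R R2 (dual S) (fun v => (dot v \o i : {linear S -> R^o})).
  move=> a u v; apply: HomP => x /=.
  by rewrite dotC linearP /= ![dot (i x) _]dotC.
exists th; split=> [f|v x]; last by rewrite thE.
have [g gE] := ext (f : {linear S -> R^o}); have [v vE] := functional_dot g.
by exists v; rewrite thE; apply: HomP => x /=; rewrite -vE gE.
Qed.

Lemma dual_short_exact (K : lmodType R) (k : {linear K -> R2}) : injective k ->
  (forall v, (forall x, dot v (i x) = 0) <-> exists z, v = k z) ->
  exists th : {linear R2 -> dual S}, short_exact k th.
Proof.
move=> ki kE; have [th [ths thE]] := dual_cover.
exists th; split => // [z|v v0].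
  by apply: HomP => x; rewrite thE; apply: (kE (k z)).2; exists z.
by apply/kE => x; rewrite -thE v0.
Qed.

(** Pulled back to R^2, an element of the bidual is a vector orthogonal to the
    orthogonal of S. *)
Lemma bidual_bijective :
  (forall y, (forall v, (forall x, dot v (i x) = 0) -> dot v y = 0) ->
     exists x, y = i x) ->
  bijective (@bidual_map R S).
Proof.
move=> iperp; have [th [ths thE]] := dual_cover.
have inj : injective (@bidual_map R S).
  move=> x y xy; apply: ii; apply/eqP; rewrite -subr_eq0; apply/eqP/dot_eq0 => v.
  rewrite dotC linearB /= -!thE.
  have := congr1 (fun F : Defs.Hom (dual S) R^o => (F : {linear _ -> _}) (th v)) xy.
  by move=> /= e; apply/eqP; rewrite subr_eq0; apply/eqP.
have /choice[g gE] : forall F, exists x, bidual_map x = F :> dual (dual S).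
  move=> F; have [y yE] := functional_dot ((F : {linear dual S -> R^o}) \o th).
  have [|x xE] := iperp y.
    move=> v v0; rewrite dotC -yE /=; have -> : th v = 0; last by rewrite linear0.
    by apply: HomP => x; rewrite thE v0.
  exists x; apply: HomP => f; have [v <-] := ths f.
  have := yE v; rewrite /= => ->; rewrite [LHS]thE -xE; exact: dotC.
by exists g => // x; apply: inj; rewrite gE.
Qed.

Lemma bidual_not_bijective y :
  (forall v, (forall x, dot v (i x) = 0) -> dot v y = 0) -> (forall x, y <> i x) ->
  ~ bijective (@bidual_map R S).
Proof.
move=> vy yi [g _ gK]; have [th [ths thE]] := dual_cover.
have [|F FE] := @factor_surj _ _ _ R^o th (dot y) ths.
  by move=> v v0; rewrite /= dotC vy // => x; rewrite -thE v0.
have := gK (F : dual (dual S)); set x := g _ => xE.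
apply: (yi x); apply/eqP; rewrite -subr_eq0; apply/eqP/dot_eq0 => v.
rewrite dotC linearB /= ![dot v y]dotC -FE -thE -xE.
by apply/eqP; rewrite subr_eq0.
Qed.
End Submodule.
End Rank2.

(** * The ring: Artinian, Noetherian and local *)

(** The coordinates on the basis 1, x, y, z, v, xz, vy, vz.  In this basis
    vx = -2 xz, y^2 = 2 xz, x^2 = vy and yz = -vy. *)
Record JS : Type := Elt { c1 : rat; cx : rat; cy : rat; cz : rat; cv : rat;
  cxz : rat; cvy : rat; cvz : rat }.

Definition js_zero := Elt 0 0 0 0 0 0 0 0.
Definition js_one := Elt 1 0 0 0 0 0 0 0.
Definition js_opp a := Elt (- c1 a) (- cx a) (- cy a) (- cz a) (- cv a)
  (- cxz a) (- cvy a) (- cvz a).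
Definition js_add a b := Elt (c1 a + c1 b) (cx a + cx b) (cy a + cy b)
  (cz a + cz b) (cv a + cv b) (cxz a + cxz b) (cvy a + cvy b) (cvz a + cvz b).
Definition js_mul a b := Elt (c1 a * c1 b)
  (c1 a * cx b + cx a * c1 b) (c1 a * cy b + cy a * c1 b)
  (c1 a * cz b + cz a * c1 b) (c1 a * cv b + cv a * c1 b)
  (c1 a * cxz b + cxz a * c1 b + (cx a * cz b + cz a * cx b)
    - (cx a * cv b + cv a * cx b) *+ 2 + (cy a * cy b) *+ 2)
  (c1 a * cvy b + cvy a * c1 b + cx a * cx b
    + (cy a * cv b + cv a * cy b) - (cy a * cz b + cz a * cy b))
  (c1 a * cvz b + cvz a * c1 b + (cz a * cv b + cv a * cz b)).

Lemma js_eq a b : [/\ c1 a = c1 b, cx a = cx b, cy a = cy b & cz a = cz b] ->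
  [/\ cv a = cv b, cxz a = cxz b, cvy a = cvy b & cvz a = cvz b] -> a = b.
Proof. by case: a b => ???????? [????????] /= [-> -> -> ->] [-> -> -> ->]. Qed.

HB.instance Definition _ := gen_eqMixin JS.
HB.instance Definition _ := gen_choiceMixin JS.

Fact js_addA : associative js_add.
Proof. by move=> a b c; apply: js_eq; split => /=; ring. Qed.
Fact js_addC : commutative js_add.
Proof. by move=> a b; apply: js_eq; split => /=; ring. Qed.
Fact js_add0 : left_id js_zero js_add.
Proof. by move=> a; apply: js_eq; split => /=; ring. Qed.
Fact js_addN : left_inverse js_zero js_opp js_add.
Proof. by move=> a; apply: js_eq; split => /=; ring. Qed.
HB.instance Definition _ := GRing.isZmodule.Build JS js_addA js_addC js_add0 js_addN.

Fact js_mulA : associative js_mul.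
Proof. by move=> a b c; apply: js_eq; split => /=; ring. Qed.
Fact js_mulC : commutative js_mul.
Proof. by move=> a b; apply: js_eq; split => /=; ring. Qed.
Fact js_mul1 : left_id js_one js_mul.
Proof. by move=> a; apply: js_eq; split => /=; ring. Qed.
Fact js_mulDl : left_distributive js_mul js_add.
Proof. by move=> a b c; apply: js_eq; split => /=; ring. Qed.
Fact js_one_neq0 : js_one != js_zero.
Proof. by apply/eqP => -[]. Qed.
HB.instance Definition _ :=
  GRing.Zmodule_isComNzRing.Build JS js_mulA js_mulC js_mul1 js_mulDl js_one_neq0.

Definition cst (a : rat) : JS := Elt a 0 0 0 0 0 0 0.
Definition X : JS := Elt 0 1 0 0 0 0 0 0.
Definition Y : JS := Elt 0 0 1 0 0 0 0 0.
Definition Z : JS := Elt 0 0 0 1 0 0 0 0.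
Definition V : JS := Elt 0 0 0 0 1 0 0 0.

Lemma js_addE (a b : JS) : a + b = js_add a b. Proof. by []. Qed.
Lemma js_oppE (a : JS) : - a = js_opp a. Proof. by []. Qed.
Lemma js_mulE (a b : JS) : a * b = js_mul a b. Proof. by []. Qed.
Lemma js_zeroE : (0 : JS) = js_zero. Proof. by []. Qed.
Lemma js_oneE : (1 : JS) = js_one. Proof. by []. Qed.
Definition jsE := (js_addE, js_oppE, js_mulE, js_zeroE, js_oneE).

(** With n the nilpotent part of a divided by its constant term, n^3 = 0 and
    1 - n + n^2 inverts 1 + n. *)
Lemma js_unit (a : JS) : c1 a != 0 -> exists b, b * a = 1.
Proof.
move=> a0; pose n := cst (c1 a)^-1 * a - 1.
exists ((1 - n + n * n) * cst (c1 a)^-1).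
apply: js_eq; rewrite /n !jsE; split => /=; field => //.
Qed.

Definition coord (i : nat) (a : JS) : rat :=
  nth 0 [:: c1 a; cx a; cy a; cz a; cv a; cxz a; cvy a; cvz a] i.

Lemma coordB i (a b : JS) k : coord i (a - cst k * b) = coord i a - k * coord i b.
Proof.
rewrite !jsE /coord; do 8 (case: i => [|i] /=; first by ring).
by rewrite nth_nil mulr0 subr0.
Qed.

Lemma coord_eq0 (a : JS) : (forall i, (i < 8)%N -> coord i a = 0) -> a = 0.
Proof.
move=> a0; apply: js_eq; split.
- exact: (a0 0%N). - exact: (a0 1%N). - exact: (a0 2%N). - exact: (a0 3%N).
- exact: (a0 4%N). - exact: (a0 5%N). - exact: (a0 6%N). - exact: (a0 7%N).
Qed.

Section ChainConditions.
Local Open Scope classical_set_scope.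

(** The positions of the leading coordinates of elements of I, the analogue of
    the pivots of an echelon form. *)
Definition lead (I : set JS) (j : nat) : Prop :=
  exists2 a, I a & (forall i, (i < j)%N -> coord i a = 0) /\ coord j a != 0.

(** Gaussian elimination: the leading coordinates of an element of J are
    cancelled one after the other by elements of I. *)
Lemma ideal_lead_eq (I J : set JS) : @is_ideal JS I -> @is_ideal JS J ->
  I `<=` J -> (forall j, lead J j -> lead I j) -> I = J.
Proof.
move=> [I0 ID IM] [J0 JD JM] IJ IJl; apply/seteqP; split=> // a Ja.
have H d j : (8 <= j + d)%N -> forall b, J b ->
    (forall i, (i < j)%N -> coord i b = 0) -> I b.
  elim: d j => [|d IH] j jd b Jb b0.
    by rewrite (coord_eq0 (a := b)) // => i i8; apply: b0; apply: leq_trans i8 _; rewrite -(addn0 j).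
  have step c : J c -> (forall i, (i < j)%N -> coord i c = 0) ->
      coord j c = 0 -> I c.
    move=> Jc c0 cj; apply: (IH j.+1) => //; first by rewrite addSnnS.
    by move=> i; rewrite ltnS leq_eqVlt => /predU1P[->|/c0].
  have [bj|bj] := eqVneq (coord j b) 0; first exact: step.
  have [c Ic [c0 cj]] := IJl j (ex_intro2 _ _ b Jb (conj b0 bj)).
  pose k := coord j b / coord j c.
  have Ik : I (cst k * c) by exact: IM.
  rewrite -(subrK (cst k * c) b); apply: ID => //; apply: step.
  - apply: JD => //; rewrite -mulN1r; apply: JM; exact: IJ.
  - by move=> i ij; rewrite coordB b0 // c0 // mulr0 subr0.
  - by rewrite coordB /k mulfVK // subrr.
exact: (H 8 0%N).
Qed.

Lemma mono_stable (P : nat -> nat -> Prop) (m : nat) :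
  (forall j n, P j n -> P j n.+1) ->
  exists N, forall j n, (j < m)%N -> (N <= n)%N -> P j n -> P j N.
Proof.
move=> mono; have monole j n k : (n <= k)%N -> P j n -> P j k.
  by move=> /subnK <-; elim: (k - n)%N => //= d IH Pn; apply/mono/IH.
elim: m => [|m [N HN]]; first by exists 0%N.
have [[n0 Pn0]|nP] := pselect (exists n, P m n).
  exists (maxn N n0) => j n; rewrite ltnS leq_eqVlt => /predU1P[->|jm] nN Pn.
    exact: monole (leq_maxr _ _) Pn0.
  apply: monole (leq_maxl _ _) (HN j n jm _ Pn).
  exact: leq_trans (leq_maxl _ _) nN.
exists N => j n; rewrite ltnS leq_eqVlt => /predU1P[->|jm] nN Pn; last exact: HN Pn.
by case: nP; exists n.
Qed.

Lemma lead_lt8 I j : lead I j -> (j < 8)%N.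
Proof. by case=> a _ [_ +]; rewrite ltnNge; apply: contra => j8; rewrite /coord nth_default. Qed.

(** An ascending chain of ideals has increasing sets of leading positions, and
    there are only eight positions. *)
Lemma js_noetherian : noetherian_ring JS.
Proof.
move=> I Iid Imono.
have [|N HN] := @mono_stable (fun j n => lead (I n) j) 8.
  by move=> j n [a Ia ?]; exists a => //; exact: Imono.
have sub n : (N <= n)%N -> I N `<=` I n.
  move=> /subnK <-; elim: (n - N)%N => //= d IH; exact: subset_trans IH (Imono _).
exists N => n Nn; apply/esym/ideal_lead_eq => //; first exact: sub.
by move=> j lj; exact: HN (lead_lt8 lj) Nn lj.
Qed.

Lemma js_artinian : artinian_ring JS.
Proof.
move=> I Iid Imono.
have [|N HN] := @mono_stable (fun j n => ~ lead (I n) j) 8.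
  by move=> j n + [a Ia ?]; apply; exists a => //; exact: Imono.
have sub n : (N <= n)%N -> I n `<=` I N.
  move=> /subnK <-; elim: (n - N)%N => //= d IH; exact: subset_trans (Imono _) IH.
exists N => n Nn; apply/ideal_lead_eq => //; first exact: sub.
by move=> j lj; apply: contrapT => nl; exact: HN (lead_lt8 lj) Nn nl lj.
Qed.

Lemma ideal_setT (I : set JS) a : @is_ideal JS I -> I a -> c1 a != 0 -> I = setT.
Proof.
move=> [_ _ IM] Ia a0; have [b ba] := js_unit a0.
by apply/seteqP; split=> // c _; rewrite -(mulr1 c) -ba; exact: (IM _ _ (IM _ _ Ia)).
Qed.

Lemma js_local : local_ring JS.
Proof.
pose m : set JS := [set a | c1 a = 0].
have mid : @is_ideal JS m.
  split=> // [a b|a b]; rewrite /m /= ?jsE /= => ->; last exact: mulr0.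
  by move=> ->; exact: addr0.
have mT : m <> setT by move=> mE; have : m 1 by rewrite mE.
have big (I : set JS) : @is_ideal JS I -> ~ (I `<=` m) -> I = setT.
  move=> Iid /existsNP[a /not_implyP[Ia /eqP ma]]; exact: ideal_setT Iid Ia ma.
exists m; split=> [|m' [m'id m'T m'max]].
  split=> // I Iid mI; have [Im|nIm] := pselect (I `<=` m); last by right; exact: big.
  by left; apply/seteqP.
have sub : m' `<=` m by apply: contrapT => /(big _ m'id).
by have [|] := m'max m mid sub.
Qed.
End ChainConditions.

(** * The two families of matrices and their exactness *)

Definition js2 : lmodType JS := R2 JS.

Definition d (t : rat) : {linear js2 -> js2} := mat V (cst t * X) Y Z.
Definition dT (t : rat) : {linear js2 -> js2} := mat V Y (cst t * X) Z.

Lemma dot_d t u w : dot u (d t w) = dot (dT t u) w.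
Proof. exact: dot_mat. Qed.

Lemma dot_dT t u w : dot u (dT t w) = dot (d t u) w.
Proof. exact: dot_mat. Qed.

Lemma js_eqE (a b : JS) : a = b ->
  [/\ c1 a = c1 b, cx a = cx b, cy a = cy b & cz a = cz b] /\
  [/\ cv a = cv b, cxz a = cxz b, cvy a = cvy b & cvz a = cvz b].
Proof. by move=> ->. Qed.

Lemma dd t w : d (t * 2) (d t w) = 0.
Proof. by congr pair; apply: js_eq; split => /=; ring. Qed.

Lemma dTdT t w : dT t (dT (t * 2) w) = 0.
Proof. by congr pair; apply: js_eq; split => /=; ring. Qed.

Lemma pair_eqE (u w : js2) : u = w -> u.1 = w.1 /\ u.2 = w.2.
Proof. by move=> ->. Qed.

(** In degree one, the equations of d (2t) degenerate only at t = 1/4, and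
    otherwise the kernel is spanned by the two columns of d t.  In degree two, d t has to be onto, which fails
    only for t = 1/2. *)
Lemma d_exact t u : 1 <= t -> d (t * 2) u = 0 -> exists w, u = d t w.
Proof.
case: u => -[a0 ax ay az av ap aq ar] [b0 bx by_ bz bv bp bq br] t1.
case/pair_eqE => /js_eqE + /js_eqE; rewrite /=.
move=> [[_ e1 e2 e3] [e4 e5 e6 e7]] [[_ f1 f2 f3] [f4 f5 f6 f7]].
have a00 : a0 = 0 by lra.
have b00 : b0 = 0 by lra.
subst a0 b0.
have bx0 : bx = 0.
  (* the determinant of the two equations in ay and bx *)
  have : bx * (4 * t - 1) = 0 by lra.
  by move/eqP; rewrite mulf_eq0 => /orP[/eqP //|/eqP]; lra.
subst bx.
have ay0 : ay = 0 by lra.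
have az0 : az = 0 by lra.
have bv0 : bv = 0 by lra.
subst ay az bv.
have axE : ax = t * bz by lra.
have avE : av = by_ by lra.
subst ax av.
(* the coordinate bx of a preimage, from the equations ay + t bx = aq and
   2 ay + bx = bp *)
pose g := (bp - 2 * aq) / (1 - 2 * t).
have gE : g * (1 - 2 * t) = bp - 2 * aq by rewrite /g mulfVK //; apply/eqP; lra.
exists (Elt by_ (- (ap + 2 * t * br) / 2) (aq - t * g) ar (bq + ar) 0 0 0,
        Elt bz g 0 0 br 0 0 0).
by congr pair; apply: js_eq; split => /=; lra.
Qed.

(** As for d, the degenerate values now being t = 1 for the kernel of dT t in
    degree one, and t = 1/2 for dT (2t) to be onto in degree two. *)
Lemma dT_exact t u : 1 < t -> dT t u = 0 -> exists w, u = dT (t * 2) w.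
Proof.
case: u => -[a0 ax ay az av ap aq ar] [b0 bx by_ bz bv bp bq br] t1.
case/pair_eqE => /js_eqE + /js_eqE; rewrite /=.
move=> [[_ e1 e2 e3] [e4 e5 e6 e7]] [[_ f1 f2 f3] [f4 f5 f6 f7]].
have a00 : a0 = 0 by lra.
have b00 : b0 = 0 by lra.
subst a0 b0.
have ax0 : ax = 0.
  have : ax * (t - 1) = 0 by lra.
  by move/eqP; rewrite mulf_eq0 => /orP[/eqP //|/eqP]; lra.
subst ax.
have by0 : by_ = 0 by lra.
have az0 : az = 0 by lra.
have bv0 : bv = 0 by lra.
subst by_ az bv.
have bzE : bz = ay by lra.
have bxE : bx = t * 2 * av by lra.
subst bx bz.
(* the coordinate ax of a preimage, from the equations -2 ax + 2 by = ap and
   2t ax - by = bq *)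
pose g := (ap + 2 * bq) / (2 * (t * 2 - 1)).
have gE : g * (2 * (t * 2 - 1)) = ap + 2 * bq by rewrite /g mulfVK //; apply/eqP; lra.
exists (Elt av g (aq - br) ar 0 0 0 0,
        Elt ay (bp - t * 2 * ar) (t * 2 * g - bq) 0 br 0 0 0).
by congr pair; apply: js_eq; split => /=; lra.
Qed.

(** * The residue field *)

Definition residue : Type := rat.
HB.instance Definition _ := GRing.Zmodule.on residue.
Definition residue_scale (a : JS) (q : residue) : residue := c1 a * (q : rat).
Fact residue_scaleA a b q :
  residue_scale a (residue_scale b q) = residue_scale (a * b) q.
Proof. by rewrite /residue_scale /= mulrA. Qed.
Fact residue_scale1 : left_id 1 residue_scale.
Proof. by move=> q; rewrite /residue_scale /= mul1r. Qed.
Fact residue_scaleDr : right_distributive residue_scale +%R.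
Proof. by move=> a p q; rewrite /residue_scale mulrDr. Qed.
Fact residue_scaleDl q : {morph residue_scale^~ q : a b / a + b}.
Proof. by move=> a b; rewrite /residue_scale /= mulrDl. Qed.
HB.instance Definition _ := GRing.Zmodule_isLmodule.Build JS residue
  residue_scaleA residue_scale1 residue_scaleDr residue_scaleDl.

(** Each function in the list is R-linear to the residue field on the common
    zeros of the preceding ones, and only 0 is a zero of all of them; a
    submodule contained in P then has a filtration with factors k or 0. *)
Fixpoint separating (M : lmodType JS) (P : M -> Prop) (s : seq (M -> rat)) : Prop :=
  if s is f :: s' then
    (forall a u v, P u -> P v -> f (a *: u + v) = c1 a * f u + f v) /\
    separating (fun u => P u /\ f u = 0) s'
  else forall u, P u -> u = 0.

(** Peel off the functions one at a time: M' is an extension of the residue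
    field by the kernel of the first function, unless that function vanishes
    on M'. *)
Lemma Ext_residue_filtration (N M M' : lmodType JS) n (s : seq (M -> rat))
    (P : M -> Prop) (i : {linear M' -> M}) :
  is_zero (Ext (residue : lmodType JS) N n.+1) ->
  injective i -> (forall x, P (i x)) -> separating P s ->
  is_zero (Ext M' N n.+1).
Proof.
move=> Ek; elim: s M' P i => [|f s IH] M' P i ii Pi.
  move=> /= M0; apply: (Ext_retract _ Ek); exists JS^o, \0, \0, \0, \0.
  split; first exact: projective_regular.
  by move=> x; apply: ii; rewrite (M0 _ (Pi x)) /= addr0 linear0.
case=> flin fs; have [|l lE] := @linear_of JS M' (residue : lmodType JS) (f \o i).
  by move=> a u v; rewrite /= linearP flin.
have Kz : is_zero (Ext (Ker l) N n.+1).
  apply: (IH _ (fun u => P u /\ f u = 0) (i \o (\val : {linear Ker l -> M'}))) => //.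
    by move=> x y /ii /val_inj.
  by move=> x; split; [exact: Pi|have := ker_eq0 x; rewrite lE].
have [[x0 lx0]|l0] := pselect (exists x, l x <> 0).
  have ls q : exists x, l x = q.
    exists (cst (q / (l x0 : rat)) *: x0).
    rewrite linearZ; apply: (mulfVK (x := l x0 : rat)); exact/eqP.
  exact: Ext_extension (ker_short_exact ls) Kz Ek.
have {}l0 x : l x = 0 by apply: contrapT => lx; apply: l0; exists x.
have [|r rE] := @factor_inj _ M' _ _ (\val : {linear Ker l -> M'}) idfun val_inj.
  by move=> x; have [k kE] := ker_lift (l0 x); exists k.
exact: Ext_retract (stable_retract_of (i := r) (r := \val) rE) Kz.
Qed.

Definition radical2 (u : js2) : Prop := c1 u.1 = 0 /\ c1 u.2 = 0.

Lemma radical2_separating : separating radical2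
  [:: (fun u => cx u.1); (fun u => cy u.1); (fun u => cz u.1); (fun u => cv u.1);
      (fun u => cx u.2); (fun u => cy u.2); (fun u => cz u.2); (fun u => cv u.2);
      (fun u => cxz u.1); (fun u => cvy u.1); (fun u => cvz u.1);
      (fun u => cxz u.2); (fun u => cvy u.2); (fun u => cvz u.2)].
Proof.
rewrite /separating /radical2.
do 14 (split; first by
  move=> a u v hu hv; repeat match goal with H : _ /\ _ |- _ => destruct H end;
  rewrite /=; repeat match goal with H : _ = 0 |- _ => rewrite ?H; clear H end; ring).
move=> [[????????] [????????]] h /=.
by repeat match goal with H : _ /\ _ |- _ => destruct H end; simpl in *; subst.
Qed.

(** The constant terms are the coefficient of v in the first entry and that of
    z in the second entry of the image. *)
Lemma ker_d_radical t u : d t u = 0 -> radical2 u.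
Proof.
case: u => a b; case/pair_eqE => /js_eqE[_ /= [e _ _ _]] /js_eqE[[_ _ _ /= f] _].
by split=> /=; lra.
Qed.

Lemma socle_map : exists i : {linear (residue : lmodType JS) -> JS^o},
  forall q, i q = Elt 0 0 0 0 0 q 0 0.
Proof.
have [|i iE] := @linear_of JS (residue : lmodType JS) JS^o
    (fun q => Elt 0 0 0 0 0 q 0 0); last by exists i.
move=> a p q; change (a *: p + q) with (c1 a * (p : rat) + (q : rat)).
by apply: js_eq; split => /=; ring.
Qed.

(** In degree two, the image of d (1/2) is the hyperplane where this functional
    vanishes, so it splits off the residue field from the kernel of d 1. *)
Lemma residue_map : exists r : {linear Ker (d 1) -> (residue : lmodType JS)},
  forall z, r z = cxz (\val z).2 - 2 * cvy (\val z).1.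
Proof.
have [|r rE] := @linear_of JS (Ker (d 1)) (residue : lmodType JS)
    (fun z => cxz (\val z).2 - 2 * cvy (\val z).1); last by exists r.
  move=> a z z'; have := ker_eq0 z.
  have -> : \val (a *: z + z') = a *: \val z + \val z' by [].
  move: (\val z) (\val z') => [u v] [u' v'].
  case/pair_eqE => /js_eqE + /js_eqE => /= -[[_ e1 e2 e3] [e4 e5 e6 e7]].
  move=> [[_ f1 f2 f3] [f4 f5 f6 f7]].
  change (cxz (a * v + v') - 2 * cvy (a * u + u') =
    c1 a * (cxz v - 2 * cvy u) + (cxz v' - 2 * cvy u') :> rat); rewrite /=.
  have hz : cz u = 0 by lra.
  have hv : cv v = 0 by lra.
  have hy : cy u = 0 by lra.
  have hx : cx v = 0 by lra.
  have hb : cz v = 2 * cx u by lra.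
  have hc : cy v = cv u by lra.
  have hu : c1 u = 0 by lra.
  have hw : c1 v = 0 by lra.
  by rewrite hz hv hy hx hb hc hu hw; ring.
Qed.

Lemma residue_retract : stable_retract (residue : lmodType JS) (Ker (d 1)).
Proof.
have [i iE] := socle_map; have [r rE] := residue_map.
have [|j jE] := @linear_of JS JS^o js2 (fun x => (0, x)).
  by move=> a x y; congr pair; rewrite /= scaler0 addr0.
have [|i' i'E] := @factor_inj _ _ _ _ (\val : {linear Ker (d 1) -> js2})
    (j \o i) val_inj.
  move=> q; have [|z zE] := @ker_lift _ _ _ (d 1) (j (i q)); last by exists z.
  by rewrite jE iE; congr pair; apply: js_eq; split => /=; ring.
apply: (stable_retract_of (i := i') (r := r)) => q.
by rewrite rE i'E /= jE iE /= mulr0 subr0.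
Qed.

(** * The kernels of the matrices, and the theorem *)

Definition Zd (t : rat) : lmodType JS := Ker (d t).
Definition ZdT (t : rat) : lmodType JS := Ker (dT t).

Lemma Zd_cover t : 1 <= t -> exists b : {linear js2 -> Zd (t * 2)},
  (forall x, exists w, b w = x) /\ (forall w, \val (b w) = d t w).
Proof.
move=> t1; have [|b bE] := @factor_inj _ _ _ _ (\val : {linear Zd (t * 2) -> js2})
    (d t) val_inj.
  by move=> w; have [z zE] := ker_lift (dd t w); exists z.
exists b; split=> // x; have [w wE] := d_exact t1 (ker_eq0 x).
by exists w; apply: val_inj; rewrite wE -bE.
Qed.

Lemma ZdT_cover t : 1 < t -> exists b : {linear js2 -> ZdT t},
  (forall x, exists w, b w = x) /\ (forall w, \val (b w) = dT (t * 2) w).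
Proof.
move=> t1; have [|b bE] := @factor_inj _ _ _ _ (\val : {linear ZdT t -> js2})
    (dT (t * 2)) val_inj.
  by move=> w; have [z zE] := ker_lift (dTdT t w); exists z.
exists b; split=> // x; have [w wE] := dT_exact t1 (ker_eq0 x).
by exists w; apply: val_inj; rewrite wE -bE.
Qed.

Definition Zd_incl t : {linear Zd t -> js2} := \val.
Definition ZdT_incl t : {linear ZdT t -> js2} := \val.

Lemma Zd_exact t : 1 <= t -> exists b, short_exact (Zd_incl t) (b : {linear _ -> Zd (t * 2)}).
Proof.
move=> /Zd_cover[b [bs bE]]; exists b; split=> // [|x|y y0]; first exact: val_inj.
  by apply: val_inj; rewrite [LHS]bE ker_eq0.
have [|x xE] := @ker_lift _ _ _ (d t) y; first by rewrite -bE y0.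
by exists x.
Qed.

Lemma ZdT_exact t : 1 < t -> exists b, short_exact (ZdT_incl (t * 2)) (b : {linear _ -> ZdT t}).
Proof.
move=> /ZdT_cover[b [bs bE]]; exists b; split=> // [|x|y y0]; first exact: val_inj.
  by apply: val_inj; rewrite [LHS]bE ker_eq0.
have [|x xE] := @ker_lift _ _ _ (dT (t * 2)) y; first by rewrite -bE y0.
by exists x.
Qed.

Lemma Zd_extendable t : 1 < t -> extendable JS^o (Zd_incl (t * 2 * 2)).
Proof.
move=> t1; have [|b [bs bE]] := @Zd_cover (t * 2); first by lra.
apply: (functionals_extend (b := b) (B' := dT (t * 2)) bs _ (C := d t) (C' := dT t)).
- by move=> u w; rewrite [Zd_incl _ _]bE dot_d.
- by move=> u w; rewrite dot_d.
- by move=> w; apply: val_inj; rewrite [LHS]bE dd.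
- by move=> y; exact: dT_exact.
Qed.

Lemma ZdT_extendable t : 1 < t -> extendable JS^o (ZdT_incl t).
Proof.
move=> t1; have [b [bs bE]] := ZdT_cover t1.
apply: (functionals_extend (b := b) (B' := d (t * 2)) bs _
  (C := dT (t * 2 * 2)) (C' := d (t * 2 * 2))).
- by move=> u w; rewrite [ZdT_incl _ _]bE dot_dT.
- by move=> u w; rewrite dot_dT.
- by move=> w; apply: val_inj; rewrite [LHS]bE dTdT.
- by move=> y; apply: d_exact; lra.
Qed.

Definition XZ : JS := Elt 0 0 0 0 0 1 0 0.
Definition XY2 : js2 := (X, Y).

(** This cycle is not a boundary, by the next lemma: the transposed sequence
    fails to be exact at t = 1. *)
Lemma dT1_XY : dT 1 XY2 = 0.
Proof. by congr pair; apply: js_eq; split => /=; ring. Qed.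

Lemma XY_not_dT2 u : dT (1 * 2) u <> XY2.
Proof.
by case: u => a b; case/pair_eqE => /js_eqE[[/= e0 e1 e2 _] [e3 _ _ _]] _; lra.
Qed.

(** The functional sends d 2 w to the pairing of w with (x, y). *)
Lemma Zd4_not_extendable : ~ extendable JS^o (Zd_incl (1 * 2 * 2)).
Proof.
have [|b [bs bE]] := @Zd_cover (1 * 2); first by lra.
apply: (functional_not_extend (b := b) (B' := dT (1 * 2)) bs _ (y := XY2)).
- by move=> u w; rewrite [Zd_incl _ _]bE dot_d.
- move=> w w0; have [||u ->] := @d_exact 1 w; first by [].
    by rewrite -bE w0.
  by rewrite dot_d dT1_XY dotC linear0.
- exact: XY_not_dT2.
Qed.

(** The functional sends d 1 w to the pairing of w with (xz, 0), which is
    outside the image of dT 1 as that map is not onto in degree two. *)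
Lemma Zd2_not_extendable : ~ extendable JS^o (Zd_incl (1 * 2)).
Proof.
have [|b [bs bE]] := @Zd_cover 1; first by lra.
apply: (functional_not_extend (b := b) (B' := dT 1) bs _ (y := (XZ, 0))).
- by move=> u w; rewrite [Zd_incl _ _]bE dot_d.
- move=> w w0; have [|+ _] := @ker_d_radical 1 w; first by rewrite -bE w0.
  by case: w {w0} => a c /= a0; apply: js_eq; split => /=; rewrite a0; ring.
- case=> a b'; case/pair_eqE => /js_eqE + /js_eqE => /= -[[_ e1 e2 e3] [e4 e5 e6 e7]].
  by move=> [[_ f1 f2 f3] [f4 f5 f6 f7]]; lra.
Qed.

(** The functional is the projection to the summand k followed by the inclusion
    of the line k xz into R.  An extension u kills the column (v, y) of d (1/2),
    hence has no constant term, hence kills (0, xz) as well. *)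
Lemma Zd1_not_extendable : ~ extendable JS^o (Zd_incl 1).
Proof.
move=> ext; have [i iE] := socle_map; have [r rE] := residue_map.
have [g gE] := ext (i \o r); have [[u1 u2] uE] := functional_dot g.
have [|z zE] := @ker_lift _ _ _ (d 1) (V, Y).
  by congr pair; apply: js_eq; split => /=; ring.
have [|z' zE'] := @ker_lift _ _ _ (d 1) (0, XZ).
  by congr pair; apply: js_eq; split => /=; ring.
have := gE z; rewrite uE /= iE rE [Zd_incl _ _]zE /= => /js_eqE[[_ _ e _] _].
have := gE z'; rewrite uE /= iE rE [Zd_incl _ _]zE' /= => /js_eqE[_ [_ e' _ _]].
move: e e' => /=; rewrite zE zE' /=; lra.
Qed.

(** Descent on n through the summand k of Z_0, with factors k of Z_1. *)
Lemma Ext_Zd2 n : ~ is_zero (Ext (Zd (1 * 2)) JS^o n.+1).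
Proof.
have [b bse] := @Zd_exact 1 (lexx _).
elim: n => [|n IH].
  by rewrite (Ext1_extendable _ bse (@R2_projective _)); exact: Zd1_not_extendable.
rewrite (Ext_shift _ bse (@R2_projective _)) => /(Ext_retract residue_retract) E1.
apply: IH; apply: (Ext_residue_filtration E1 (i := Zd_incl (1 * 2)) val_inj _
  radical2_separating).
by move=> x; apply: (@ker_d_radical (1 * 2)); exact: ker_eq0.
Qed.

Fixpoint pow2 (j : nat) : rat := if j is j'.+1 then pow2 j' * 2 else 1.

Lemma pow2_ge1 j : 1 <= pow2 j.
Proof. by elim: j => //= j IH; lra. Qed.

Lemma pow2_gt1 j : (0 < j)%N -> 1 < pow2 j.
Proof. by case: j => //= j _; have := pow2_ge1 j; lra. Qed.

Lemma Zd_extendable_iff j : extendable JS^o (Zd_incl (pow2 j)) <-> (3 <= j)%N.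
Proof.
split; last first.
  case: j => [|[|[|j]]] // _; apply: (@Zd_extendable (pow2 j.+1)).
  exact: pow2_gt1.
case: j => [/Zd1_not_extendable|[/Zd2_not_extendable|[/Zd4_not_extendable|]]] //.
Qed.

Lemma Ext_Zd n j :
  is_zero (Ext (Zd (pow2 j.+1)) JS^o n.+1) <-> (n + 3 <= j)%N.
Proof.
elim: n j => [|n IH] j; have [b bse] := Zd_exact (pow2_ge1 j).
  by rewrite (Ext1_extendable _ bse (@R2_projective _)) Zd_extendable_iff.
case: j b bse => [b _|j b bse]; first by split=> // /Ext_Zd2.
by rewrite (Ext_shift _ bse (@R2_projective _)) IH addSn.
Qed.

Lemma Ext_ZdT t n : 1 < t -> is_zero (Ext (ZdT t) JS^o n.+1).
Proof.
elim: n t => [|n IH] t t1; have [b bse] := ZdT_exact t1;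
  have t2 : 1 < t * 2 by lra.
  by rewrite (Ext1_extendable _ bse (@R2_projective _)); exact: ZdT_extendable.
by rewrite (Ext_shift _ bse (@R2_projective _)); exact: IH.
Qed.

Lemma Zd_perp t v : 1 <= t ->
  (forall x, dot v (Zd_incl (t * 2) x) = 0) <-> exists z, v = ZdT_incl t z.
Proof.
move=> t1; have [b [bs bE]] := Zd_cover t1; split=> [v0|[z ->] x].
  have [|z zE] := @ker_lift _ _ _ (dT t) v; last by exists z.
  by apply: dot_eq0 => w; rewrite -dot_d -bE; exact: v0.
by have [w <-] := bs x; rewrite [Zd_incl _ _]bE dot_d ker_eq0 dotC linear0.
Qed.

(** The kernel of d (4t) contains every vector orthogonal to the rows of
    d (4t), and these rows are orthogonal to the kernel. *)
Lemma Zd_reflexive t : 1 < t -> reflexive_module (Zd (t * 2 * 2)).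
Proof.
move=> t1; have [|b [bs bE]] := @Zd_cover (t * 2); first by lra.
split; first exact: finite_cover bs.
apply: (bidual_bijective (i := Zd_incl _) val_inj (Zd_extendable t1)) => y yperp.
have [|z zE] := @ker_lift _ _ _ (d (t * 2 * 2)) y; last by exists z.
apply: dot_eq0 => w; rewrite dotC dot_d; apply: yperp => x.
by rewrite -dot_d ker_eq0 linear0.
Qed.

Lemma Ext_dual_Zd t n : 1 < t -> is_zero (Ext (dual (Zd (t * 2 * 2))) JS^o n.+1).
Proof.
move=> t1; have t2 : 1 < t * 2 by lra.
have [|th se] := dual_short_exact (Zd_extendable t1) (k := ZdT_incl (t * 2)) val_inj.
  by move=> v; apply: Zd_perp; lra.
case: n => [|n].
  by rewrite (Ext1_extendable _ se (@R2_projective _)); exact: ZdT_extendable.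
by rewrite (Ext_shift _ se (@R2_projective _)); exact: Ext_ZdT.
Qed.

Lemma Ext0_Zd t : ~ is_zero (Ext (Zd t) JS^o 0).
Proof.
move=> /Ext0_eq0 H; have [|z zE] := @ker_lift _ _ _ (d t) (XZ, 0).
  by congr pair; apply: js_eq; split => /=; ring.
have := H (dot (1, 0) \o Zd_incl t) z.
by rewrite -[LHS]/(dot (1, 0) (\val z)) zE => /js_eqE[_ [_ /= + _ _]]; lra.
Qed.

Lemma Ext_Img_dT t n : 1 < t -> is_zero (Ext (Img (dT t)) JS^o n.+1).
Proof.
move=> t1; have [b [bs bE]] := img_cover (dT t).
have se : short_exact (ZdT_incl t) b.
  split=> // [|x|y y0]; first exact: val_inj.
    by apply: val_inj; rewrite [LHS]bE ker_eq0.
  have [|x xE] := @ker_lift _ _ _ (dT t) y; first by rewrite -bE y0.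
  by exists x.
case: n => [|n].
  by rewrite (Ext1_extendable _ se (@R2_projective _)); exact: ZdT_extendable.
by rewrite (Ext_shift _ se (@R2_projective _)); exact: Ext_ZdT.
Qed.

Definition Img_incl t : {linear Img (dT t) -> js2} := \val.

Lemma Img_dT_extendable t : 1 <= t -> extendable JS^o (Img_incl t).
Proof.
move=> t1; have [b [bs bE]] := img_cover (dT t).
apply: (functionals_extend (b := b) (B' := d t) bs _
  (C := dT (t * 2)) (C' := d (t * 2))).
- by move=> u w; rewrite [Img_incl _ _]bE dot_dT.
- by move=> u w; rewrite dot_dT.
- by move=> w; apply: val_inj; rewrite [LHS]bE dTdT.
- by move=> y; exact: d_exact.
Qed.

Lemma Img_dT_perp t v :
  (forall x, dot v (Img_incl t x) = 0) <-> exists z, v = Zd_incl t z.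
Proof.
have [b [bs bE]] := img_cover (dT t); split=> [v0|[z ->] x].
  have [|z zE] := @ker_lift _ _ _ (d t) v; last by exists z.
  by apply: dot_eq0 => w; rewrite -dot_dT -bE; exact: v0.
by have [w <-] := bs x; rewrite [Img_incl _ _]bE dot_dT ker_eq0 dotC linear0.
Qed.

Lemma Ext_dual_Img n : ~ is_zero (Ext (dual (Img (dT (1 * 2)))) JS^o n.+1).
Proof.
have [||th se] := dual_short_exact (@Img_dT_extendable (1 * 2) _)
    (k := Zd_incl (1 * 2)) val_inj; first by lra.
  exact: Img_dT_perp.
case: n => [|n].
  by rewrite (Ext1_extendable _ se (@R2_projective _)); exact: Zd2_not_extendable.
by rewrite (Ext_shift _ se (@R2_projective _)); exact: Ext_Zd2.
Qed.

(** The orthogonal of the image of dT 2 is the kernel of d 2, which is the image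
    of d 1, and (x, y) is orthogonal to it without lying in the image. *)
Lemma Img_not_reflexive : ~ reflexive_module (Img (dT (1 * 2))).
Proof.
case=> _; have t1 : (1 : rat) <= 1 * 2 by lra.
apply: (bidual_not_bijective (i := Img_incl _) (Img_dT_extendable t1) (y := XY2)).
  move=> v /Img_dT_perp[z ->].
  have [w wE] := @d_exact 1 _ (lexx _) (ker_eq0 z).
  by rewrite [Zd_incl _ _]wE dotC dot_d dT1_XY dotC linear0.
move=> x; have [b [bs bE]] := img_cover (dT (1 * 2)).
by have [w <-] := bs x; rewrite [Img_incl _ _]bE => /esym/XY_not_dT2.
Qed.

Theorem mainTheorem1 :
  exists R : comNzRingType,
    [/\ noetherian_ring R, local_ring R & artinian_ring R] /\
    (exists M : nat -> lmodType R, forall s : nat, (1 <= s)%N ->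
       [/\ reflexive_module (M s),
           forall i : nat, is_zero (Ext (M s) R^o i) <-> (1 <= i <= s - 1)%N &
           forall i : nat, (0 < i)%N -> is_zero (Ext (dual (M s)) R^o i)]) /\
    (exists L : lmodType R,
       [/\ ~ reflexive_module L,
           forall i : nat, (0 < i)%N -> is_zero (Ext L R^o i) &
           forall i : nat, (0 < i)%N -> ~ is_zero (Ext (dual L) R^o i)]).
Proof.
exists JS; split; first by split; [exact: js_noetherian|exact: js_local|exact: js_artinian].
split.
  exists (fun s => Zd (pow2 s.+2)) => s s1; have t1 := pow2_gt1 s1; split.
  - exact: Zd_reflexive.
  - case=> [|n]; first by split=> // /Ext0_Zd.
    by rewrite Ext_Zd; case: s s1 {t1} => // s _; rewrite subn1 addn3 !ltnS.
  - by case=> // n _; exact: Ext_dual_Zd.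
exists (Img (dT (1 * 2))); split.
- exact: Img_not_reflexive.
- by case=> // n _; apply: Ext_Img_dT; lra.
- by case=> // n _; exact: Ext_dual_Img.
Qed.
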